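(* Let $d\ge1$, $K\ge1$ and $\lambda\in[1,\infty)^d$. The class $\mathrm{RMGM}(K,\lambda)$ is invariant under independent coordinate dilations: if $g\in\mathrm{RMGM}(K,\lambda)$ and $s\in(0,\infty)^d$, then $g_s(x)=g(s_1x_1,\dots,s_dx_d)$ belongs to $\mathrm{RMGM}(K,\lambda)$. Consequently, let $\vec p,\vec q\in[1,\infty)^d$ and $\alpha,\rho\in\mathbb R^d$, let $g\in \mathrm{RMGM}(K,\lambda)$ with coordinatewise even extension $f$ be such that both $\|\Pi_\alpha\widehat f_A\|_{L_{\vec q}(\mathbb R^d)}$ and $\|\Pi_\rho f\|_{L_{\vec p}(\mathbb R^d)}$ are finite and nonzero, and for $s\in(0,\infty)^d$ let $f_s$ be the coordinatewise even extension of $g_s$. If there is a constant $C<\infty$ such that $$\|\Pi_\alpha\widehat{(f_s)}_A\|_{L_{\vec q}(\mathbb R^d)}\le C\,\|\Pi_\rho f_s\|_{L_{\vec p}(\mathbb R^d)}\qquad\text{for all }s\in(0,\infty)^d,$$ then necessarily $$\rho_k=1-\frac1{p_k}-\frac1{q_k}-\alpha_k\qquad\text{for every }k=1,\dots,d.$$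
   Context: Products, quotients and inequalities of vectors are componentwise. For $r\in(0,\infty)^d$ put $\mathcal Q(r)=\prod_{k=1}^d(0,r_k)$ and $\mathcal Q^*(r)=\prod_{k=1}^d[r_k,\infty)$. Upper-tail potentials. A complex Radon measure on $(0,\infty)^d$ is understood locally (its total variation $|\mu|$ is finite on compact sets but not necessarily on the whole space). A measurable function $g:(0,\infty)^d\to\mathbb C$ is an upper-tail potential if there is a complex Radon measure $\mu_g$ on $(0,\infty)^d$ such that $g(x)=\mu_g(\mathcal Q^*(x))$ for almost every $x$ and $$\mathcal M_g(r):=\int_{(0,\infty)^d}\prod_{k=1}^d\min\{r_k,t_k\}\,d|\mu_g|(t)<\infty\quad\text{for every }r\in(0,\infty)^d.$$ The second condition implies $|\mu_g|(\mathcal Q^*(x))<\infty$ for every $x$. The measure $\mu_g$ is uniquely determined by the almost-everywhere class of $g$, and $g$ is always represented by its canonical version $g(x)=\mu_g(\mathcal Q^*(x))$ for every $x$. RMGM. For $K\ge1$ and $\lambda\in[1,\infty)^d$, an upper-tail potential $g$ belongs to $\mathrm{RMGM}(K,\lambda)$ if $\mathcal M_g(r)\le K\int_{\mathcal Q(\lambda r)}|g(x)|\,dx$ for every $r\in(0,\infty)^d$. Even extension. $f(x)=g(|x_1|,\dots,|x_d|)$ when $x_1\cdots x_d\ne0$; the values on the coordinate hyperplanes are arbitrary measurable values (irrelevant almost everywhere). Abel Fourier transform. For $\varepsilon\in(0,\infty)^d$ put $\widehat f_\varepsilon(\xi)=\int_{\mathbb R^d}f(x)e^{-\sum_k\varepsilon_k|x_k|}e^{ix\cdot\xi}\,dx$.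 For $\xi$ with no zero coordinate, $\widehat f_A(\xi)=\lim_{\varepsilon\to0+}\widehat f_\varepsilon(\xi)$, where all $\varepsilon_k\downarrow0$ along an arbitrary path (the limit being independent of the path); this limit exists for even extensions of upper-tail potentials. If some $\xi_k=0$, set $\widehat f_A(\xi)=0$. Weights and mixed norms. For $\rho\in\mathbb R^d$, $\Pi_\rho(x)=\prod_k|x_k|^{\rho_k}$ if $x_1\cdots x_d\neq0$, and $\Pi_\rho(x)=0$ on the coordinate hyperplanes. For $\vec s=(s_1,\dots,s_d)$ with $1\le s_k<\infty$, $$\|F\|_{L_{\vec s}(\mathbb R^d)}=\left(\int_{\mathbb R}\cdots\left(\int_{\mathbb R}|F(x_1,\dots,x_d)|^{s_1}\,dx_1\right)^{s_2/s_1}\cdots dx_d\right)^{1/s_d}$$ (the $x_1$ integral is innermost, $x_d$ outermost). *)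

(* Defs.v *)
From HB Require Import structures.
From mathcomp Require Import all_boot all_order all_algebra.
From mathcomp Require Import complex.
From mathcomp Require Import all_classical all_reals all_analysis.
Set Implicit Arguments. Unset Strict Implicit. Unset Printing Implicit Defensive.
Import Order.TTheory GRing.Theory Num.Theory.
Import numFieldNormedType.Exports.
Local Open Scope classical_set_scope.
Local Open Scope ring_scope.
Local Open Scope complex_scope.

(* R^d is the type of d-tuples with its product sigma-algebra; the alias
   measurableTypeR R of R is the one carrying the Borel sigma-algebra that
   lebesgue_measure is defined on. *)
Notation point_of R d := (d.-tuple (measurableTypeR R)).

Section lebesgue_tuple.
Context {R : realType}.

Definition cons_pair n (p : measurableTypeR R * point_of R n) :
  point_of R n.+1 := [tuple of p.1 :: p.2].

Lemma measurable_cons_pair n : measurable_fun setT (@cons_pair n).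
Proof. exact: measurable_cons. Qed.

Section step.
Variables (n : nat) (m : {sigma_finite_measure set (point_of R n) -> \bar R}).

Definition lebesgue_step : set (point_of R n.+1) -> \bar R :=
  pushforward (@lebesgue_measure R \x m)%E (@cons_pair n).

Let step0 : lebesgue_step set0 = 0%E.
Proof. by rewrite /lebesgue_step /pushforward preimage_set0 measure0. Qed.

Let step_ge0 A : (0 <= lebesgue_step A)%E.
Proof. exact: (measure_ge0 (@lebesgue_measure R \x m)%E). Qed.

Let step_additive : semi_sigma_additive lebesgue_step.
Proof.
move=> F mF tF mUF; rewrite /lebesgue_step /pushforward preimage_bigcup.
apply: (@measure_semi_sigma_additive _ _ _ (@lebesgue_measure R \x m)%E).
- by move=> k; rewrite -[X in measurable X]setTI; exact: measurable_cons_pair.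
- apply/trivIsetP => /= i j _ _ ij; rewrite -preimage_setI.
  by move/trivIsetP : tF => /(_ _ _ _ _ ij) ->//; rewrite preimage_set0.
- rewrite -preimage_bigcup -[X in measurable X]setTI.
  exact: measurable_cons_pair.
Qed.

HB.instance Definition _ := isMeasure.Build _ _ _ lebesgue_step
  step0 step_ge0 step_additive.

Let step_sigma_finite : sigma_finite setT lebesgue_step.
Proof.
have /sigma_finiteP[F [FT ndF Foo]] := sigma_finiteT (@lebesgue_measure R).
have /sigma_finiteP[G [GT ndG Goo]] := sigma_finiteT m.
pose split (x : point_of R n.+1) : measurableTypeR R * point_of R n :=
  (thead x, [tuple of behead x]).
have msplit : measurable_fun setT split.
  apply: measurable_fun_pair; first exact: measurable_tnth.
  exact: measurable_behead.
have splitK : cancel (@cons_pair n) split.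
  move=> [a b]; rewrite /split /cons_pair/= theadE; congr pair.
  exact: val_inj.
exists (fun i => split @^-1` (F i `*` G i)).
  apply/esym; rewrite -subTset => x _.
  have : [set: measurableTypeR R] (split x).1 by [].
  have : [set: point_of R n] (split x).2 by [].
  rewrite FT GT => -[j _ Gj] [i _ Fi]; exists (maxn i j) => //; split.
    by move: Fi; apply/subsetPset/ndF/leq_maxl.
  by move: Gj; apply/subsetPset/ndG/leq_maxr.
move=> i; have [mF Fi] := Foo i; have [mG Gi] := Goo i; split.
  by rewrite -[X in measurable X]setTI; apply: msplit => //; exact: measurableX.
rewrite /lebesgue_step /pushforward -comp_preimage.
rewrite (_ : split \o _ = id); last by apply/funext => p /=; rewrite splitK.
by rewrite preimage_id product_measure1E// lte_mul_pinfty// ge0_fin_numE.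
Qed.

HB.instance Definition _ := Measure_isSigmaFinite.Build _ _ _ lebesgue_step
  step_sigma_finite.

Definition lebesgue_stepM :
  {sigma_finite_measure set (point_of R n.+1) -> \bar R} := lebesgue_step.
End step.

Fixpoint lebesgue_tuple n :
    {sigma_finite_measure set (point_of R n) -> \bar R} :=
  match n with
  | 0 => dirac ([tuple] : point_of R 0)
  | k.+1 => lebesgue_stepM (lebesgue_tuple k)
  end.

End lebesgue_tuple.

Section orthant.
Context {R : realType} {d : nat}.
Implicit Types (x y : point_of R d) (r s : 'I_d -> R).

Definition positive s := forall k, 0 < s k.

Definition orthant : set (point_of R d) := [set x | forall k, 0 < tnth x k].

Definition open_box r : set (point_of R d) :=
  [set x | forall k, 0 < tnth x k < r k].

Definition upper_box x : set (point_of R d) :=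
  [set y | forall k, tnth x k <= tnth y k].

Definition scale s x : point_of R d := [tuple s k * tnth x k | k < d].

Definition absv x : point_of R d := [tuple `|tnth x k| | k < d].

Definition off_hyperplanes x := [forall k, tnth x k != 0].

(* d-tuples carry no topology in the library; row vectors do. *)
Definition row_of x : 'rV[R]_d := \row_k tnth x k.

Definition compact_in_orthant (K : set (point_of R d)) :=
  compact (row_of @` K) /\ K `<=` orthant.

Definition relatively_compact (A : set (point_of R d)) :=
  exists2 K, compact_in_orthant K & A `<=` K.

End orthant.
Arguments orthant : clear implicits.

Section complex_radon_measure.
Context {R : realType} {d : nat}.
Implicit Types (A B : set (point_of R d)) (mu : set (point_of R d) -> R[i]).

Definition variation_sums mu A : set (\bar R) :=
  [set v | exists F : (set (point_of R d))^nat, exists n,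
    [/\ forall i, [/\ measurable (F i), relatively_compact (F i) & F i `<=` A],
        trivIset setT F
      & v = (\sum_(i < n) Normc.normc (mu (F i)))%:E]].

(* A complex Radon measure, understood locally, only assigns values to the
   relatively compact Borel subsets of the orthant; its total variation is
   defined on every Borel set. *)
Definition complex_variation mu A : \bar R := ereal_sup (variation_sums mu A).

Record complex_radon := ComplexRadon {
  radon_val :> set (point_of R d) -> R[i];
  radon_additive : forall F : (set (point_of R d))^nat,
    (forall n, measurable (F n)) -> trivIset setT F ->
    relatively_compact (\bigcup_n F n) ->
    (fun n => \sum_(i < n) radon_val (F i)) @ \oo -->
      (radon_val (\bigcup_n F n) : R[i]^o);
  radon_locally_finite : forall K,
    compact_in_orthant K -> (complex_variation radon_val K < +oo)%E }.

Definition radon_variation (mu : complex_radon) : set (point_of R d) -> \bar R :=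
  complex_variation mu.

Section variation_measure.
Variable mu : complex_radon.
Local Open Scope ereal_scope.

Lemma relatively_compactS A B :
  A `<=` B -> relatively_compact B -> relatively_compact A.
Proof. by move=> AB [K cK BK]; exists K => //; exact: subset_trans BK. Qed.

Lemma relatively_compact0 : relatively_compact (set0 : set (point_of R d)).
Proof.
exists set0 => //; split; last exact: sub0set.
by rewrite image_set0; exact: compact0.
Qed.

Lemma radon_val0 : mu set0 = 0%R.
Proof.
have t0 : trivIset setT (fun _ : nat => set0 : set (point_of R d)).
  by move=> i j _ _ [x []].
have := @radon_additive mu _ (fun=> measurable0) t0.
rewrite bigcup_const; last by exists 0%N.
move=> /(_ relatively_compact0) h.
have {}h : (fun n => (mu set0 : R[i]^o) *+ n)%R @ \oo --> (mu set0 : R[i]^o).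
  apply: cvg_trans h; apply: near_eq_cvg; apply: nearW => n.
  by rewrite sumr_const card_ord.
have h1 : (fun n => (mu set0 : R[i]^o) *+ n.+1)%R @ \oo --> (mu set0 : R[i]^o).
  by rewrite -(cvg_shiftS (fun n => (mu set0 : R[i]^o) *+ n)%R) in h.
have := cvgB h1 h; rewrite subrr => h2.
have {}h2 : (fun=> mu set0 : R[i]^o) @ \oo --> (0 : R[i]^o)%R.
  apply: cvg_trans (h2 _); apply: near_eq_cvg; apply: nearW => n.
  by rewrite /= fctE mulrS addrK.
have cst : (fun=> mu set0 : R[i]^o) @ \oo --> (mu set0 : R[i]^o).
  by apply: cvg_cst.
exact: (cvg_unique (@norm_hausdorff _ R[i]^o) cst h2).
Qed.

Let variation_sums0 A : variation_sums mu A 0.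
Proof.
exists (fun=> set0), 0%N; split=> [i||]; last by rewrite big_ord0.
  by split=> //; exact: relatively_compact0.
by move=> i j _ _ [x []].
Qed.

Let variation_ge0 A : 0 <= radon_variation mu A.
Proof. exact: ereal_sup_ubound. Qed.

Let variation0 : radon_variation mu set0 = 0.
Proof.
apply/eqP; rewrite eq_le variation_ge0 andbT.
apply: ge_ereal_sup => _ [F [n [FA _ ->]]].
rewrite lee_fin big1// => i _; have [_ _] := FA i.
by rewrite subset0 => ->; rewrite radon_val0 Normc.normc0.
Qed.

Let le_variation A B : A `<=` B -> radon_variation mu A <= radon_variation mu B.
Proof.
move=> AB; apply: ge_ereal_sup => _ [F [n [FA tF ->]]].
apply: ereal_sup_ubound; exists F, n; split=> // i.
by have [? ? FiA] := FA i; split=> //; exact: subset_trans AB.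
Qed.

Let variation_superadditive A B : A `&` B = set0 ->
  radon_variation mu A + radon_variation mu B <= radon_variation mu (A `|` B).
Proof.
move=> AB0.
suff H x y : variation_sums mu A x -> variation_sums mu B y ->
    x + y <= radon_variation mu (A `|` B).
  have [->|Voo] := eqVneq (radon_variation mu (A `|` B)) +oo; first by rewrite leey.
  have V_fin : radon_variation mu (A `|` B) \is a fin_num.
    by rewrite ge0_fin_numE ?ltey.
  have VA_fin : radon_variation mu A \is a fin_num.
    rewrite ge0_fin_numE//; apply: (@le_lt_trans _ _ (radon_variation mu (A `|` B))).
      by apply: le_variation; left.
    by rewrite ltey.
  rewrite -leeBrDl//; apply: ge_ereal_sup => y By.
  rewrite leeBrDl// addeC -leeBrDl; last first.
    by case: By => [F [n [_ _ ->]]].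
  apply: ge_ereal_sup => x Ax; rewrite leeBrDl ?[_ + x]addeC; first exact: H.
  by case: By => [F [n [_ _ ->]]].
move=> [F [n [FA tF ->]]] [G [m [GB tG ->]]].
pose H i := if (i < n)%N then F i else G (i - n)%N.
apply: ereal_sup_ubound; exists H, (n + m)%N; split.
- move=> i; rewrite /H; case: ifP => _.
    by have [? ? ?] := FA i; split=> //; exact: subset_trans (@subsetUl _ _ _).
  have [? ? ?] := GB (i - n)%N.
  by split=> //; exact: subset_trans (@subsetUr _ _ _).
- have FG i j : ~ ((F i `&` G j) !=set0).
    move=> [z [Fz Gz]]; have [_ _ FiA] := FA i; have [_ _ GjB] := GB j.
    by have : set0 z by rewrite -AB0; split; [exact: FiA|exact: GjB].
  move=> i j _ _; rewrite /H; case: ltnP => ni; case: ltnP => nj.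
  + exact: tF.
  + by move=> /FG.
  + by rewrite setIC => /FG.
  + by move=> /tG -/(_ I I) /(congr1 (addn n)); rewrite !subnKC.
- rewrite -EFinD; congr EFin; rewrite big_split_ord/=; congr (_ + _)%R.
    by apply: eq_bigr => i _; rewrite /H/= ltn_ord.
  by apply: eq_bigr => i _; rewrite /H/= ltnNge leq_addr/= addKn.
Qed.

Let normc_cvg_le (u : nat -> R[i]^o) (l : R[i]^o) (c : R) :
  u @ \oo --> l -> (forall n, Normc.normc (u n) <= c)%R ->
  (Normc.normc l <= c)%R.
Proof.
move=> ul uc; rewrite leNgt; apply/negP => cl.
have e0 : (0 < (Normc.normc l - c)%:C)%R by rewrite ltcR subr_gt0.
have /cvgrPdist_lt/(_ _ e0)[N _ /(_ N (leqnn _))] := ul.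
move=> h; have {}h : (Normc.normc (l - u N) < Normc.normc l - c)%R.
  by rewrite -ltcR.
have := le_normcD (l - u N)%R (u N); rewrite subrK leNgt => /negP; apply.
by rewrite -(subrK c (Normc.normc l)) ltr_leD.
Qed.

Let normc_ge0 (z : R[i]) : (0 <= Normc.normc z)%R.
Proof. by case: z => a b; exact: sqrtr_ge0. Qed.

Let variation_additive : semi_sigma_additive (radon_variation mu).
Proof.
move=> A mA tA mUA.
have V0 k : (0 <= k)%N -> true -> 0 <= radon_variation mu (A k) by [].
suff -> : radon_variation mu (\bigcup_n A n) = \sum_(0 <= k <oo) radon_variation mu (A k).
  exact: is_cvg_nneseries.
apply/eqP; rewrite eq_le; apply/andP; split; last first.
  apply: lime_le; first exact: is_cvg_nneseries.
  apply: nearW => N.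
  apply: (@le_trans _ _ (radon_variation mu (\bigcup_(k in `I_N) A k))); last first.
    by apply: le_variation => x [k _ Ax]; exists k.
  elim: N => [|N IH]; first by rewrite big_geq.
  rewrite big_nat_recr//=; apply: (le_trans (leeD2r _ IH)).
  apply: le_trans (variation_superadditive _) _.
    rewrite -subset0 => x [[k /= kN Ax] ANx].
    by have := tA k N I I (ex_intro _ x (conj Ax ANx)) => kE; rewrite kE ltnn in kN.
  apply: le_variation => x [[k /= kN Ax]|ANx]; last by exists N => /=.
  by exists k => //=; exact: ltnW.
apply: ge_ereal_sup => _ [F [n [FA tF ->]]].
have Fj i : (Normc.normc (mu (F i)))%:E <=
    \sum_(0 <= j <oo) (Normc.normc (mu (F i `&` A j)))%:E.
  have [mF rF FiA] := FA i.
  have s0 : 0 <= \sum_(0 <= j <oo) (Normc.normc (mu (F i `&` A j)))%:E.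
    by apply: nneseries_ge0 => j _ _; rewrite lee_fin.
  have [->|soo] := eqVneq (\sum_(0 <= j <oo) (Normc.normc (mu (F i `&` A j)))%:E) +oo.
    by rewrite leey.
  rewrite -[leRHS]fineK; last by rewrite ge0_fin_numE ?ltey.
  rewrite lee_fin.
  have FAE : \bigcup_j (F i `&` A j) = F i by rewrite -setI_bigcupr; exact/setIidPl.
  have mFA j : measurable (F i `&` A j) by exact: measurableI.
  have tFA : trivIset setT (fun j => F i `&` A j) by exact: trivIset_setIl.
  have := @radon_additive mu _ mFA tFA.
  rewrite FAE => /(_ rF) /normc_cvg_le; apply => N.
  rewrite -lee_fin fineK; last by rewrite ge0_fin_numE ?ltey.
  apply: (@le_trans _ _ (\sum_(0 <= j < N) (Normc.normc (mu (F i `&` A j)))%:E)).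
    rewrite big_mkord sumEFin lee_fin.
    elim/big_ind2 : _ => [|x1 x2 y1 y2 h1 h2|//]; first by rewrite Normc.normc0.
    by apply: le_trans (le_normcD _ _) _; exact: lerD.
  by apply: nneseries_lim_ge => j _ _; rewrite lee_fin.
rewrite -sumEFin.
apply: (@le_trans _ _ (\sum_(i < n) \sum_(0 <= j <oo)
    (Normc.normc (mu (F i `&` A j)))%:E)); first by apply: lee_sum => i _.
rewrite -nneseries_sum; last by move=> i j _; rewrite lee_fin.
apply: lee_nneseries => [j _ _|j _].
  by apply: sume_ge0 => i _; rewrite lee_fin.
rewrite sumEFin; apply: ereal_sup_ubound; exists (fun i => F i `&` A j), n.
split=> //; last exact: trivIset_setIr.
move=> i; have [mF rF _] := FA i; split; first exact: measurableI.
  by apply: relatively_compactS rF.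
exact: subIsetr.
Qed.

HB.instance Definition _ := isMeasure.Build _ _ _ (radon_variation mu)
  variation0 variation_ge0 variation_additive.

End variation_measure.
End complex_radon_measure.
Arguments complex_radon : clear implicits.

Section upper_tail_potentials.
Context {R : realType} {d : nat}.
Implicit Types (g : point_of R d -> R[i]) (mu : complex_radon R d).
Implicit Types (r s lam : 'I_d -> R) (x t : point_of R d).

Definition exhaustion (n : nat) : set (point_of R d) :=
  [set t | forall k, n.+1%:R^-1 <= tnth t k <= n.+1%:R].

(* Value of mu on a Borel set A of the orthant that need not be relatively
   compact but on which the total variation of mu is finite. *)
Definition radon_ext mu (A : set (point_of R d)) : R[i] :=
  lim ((fun n => mu (A `&` exhaustion n) : R[i]^o) @ \oo).

Definition potential_mass mu r : \bar R :=
  (\int[radon_variation mu]_(t in orthant R d)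
    (\prod_(k < d) Num.min (r k) (tnth t k))%:E)%E.

Definition cmeasurable_fun (D : set (point_of R d)) g :=
  measurable_fun D (fun x => complex.Re (g x)) /\
  measurable_fun D (fun x => complex.Im (g x)).

Definition upper_tail_measure g mu :=
  (forall r, positive r -> (potential_mass mu r < +oo)%E) /\
  {ae lebesgue_tuple d,
    forall x, orthant R d x -> g x = radon_ext mu (upper_box x)}.

Definition upper_tail_potential g :=
  cmeasurable_fun (orthant R d) g /\ exists mu, upper_tail_measure g mu.

Definition canonical_version g :=
  exists2 mu, upper_tail_measure g mu &
    forall x, orthant R d x -> g x = radon_ext mu (upper_box x).

(* mu is determined by the almost-everywhere class of g, so quantifying it
   existentially amounts to speaking of the measure of g. *)
Definition RMGM (K : R) lam g :=
  cmeasurable_fun (orthant R d) g /\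
  exists2 mu, upper_tail_measure g mu &
    forall r, positive r ->
      (potential_mass mu r <=
       K%:E * \int[lebesgue_tuple d]_(x in open_box (fun k => lam k * r k)%R)
                (Normc.normc (g x))%:E)%E.

Definition dilate s g : point_of R d -> R[i] := fun x => g (scale s x).

Definition even_extension g (f : point_of R d -> R[i]) :=
  cmeasurable_fun setT f /\
  forall x, off_hyperplanes x -> f x = g (absv x).

End upper_tail_potentials.

Section abel_fourier_transform.
Context {R : realType} {d : nat}.
Implicit Types (f : point_of R d -> R[i]) (x xi : point_of R d).
Implicit Types (eps : 'rV[R]_d).

Definition cintegral (f : point_of R d -> R[i]) : R[i] :=
  (\int[lebesgue_tuple d]_x complex.Re (f x)) +i*
  (\int[lebesgue_tuple d]_x complex.Im (f x)).

Definition cis (t : R) : R[i] := cos t +i* sin t.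

Definition damped_fourier f eps xi : R[i]^o :=
  cintegral (fun x =>
    f x * (expR (- \sum_(k < d) eps ord0 k * `|tnth x k|))%:C
        * cis (\sum_(k < d) tnth x k * tnth xi k)).

Definition zero_plus : set_system 'rV[R]_d :=
  within [set eps : 'rV[R]_d | forall k, 0 < eps ord0 k] (nbhs (0 : 'rV[R]_d)).

Definition abel_fourier f xi : R[i] :=
  if off_hyperplanes xi
  then lim (damped_fourier f eps xi @[eps --> zero_plus])
  else 0.

End abel_fourier_transform.

Section weighted_mixed_norms.
Context {R : realType}.

Definition weight d (rho : 'I_d -> R) (x : point_of R d) : R :=
  if off_hyperplanes x then \prod_(k < d) `|tnth x k| `^ rho k else 0.

(* The first coordinate is integrated first (innermost). *)
Fixpoint mixed_norm d : ('I_d -> R) -> (point_of R d -> \bar R) -> \bar R :=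
  match d with
  | 0 => fun _ F => F [tuple]
  | n.+1 => fun s F =>
      mixed_norm (fun k => s (lift ord0 k))
        (fun y : point_of R n =>
          Lnorm (@lebesgue_measure R) (s ord0)%:E
            (fun t => F (cons_pair (t, y))))
  end.

Definition weighted_norm d (s rho : 'I_d -> R) (F : point_of R d -> R[i]) :
    \bar R :=
  mixed_norm s (fun x => (Normc.normc ((weight rho x)%:C * F x))%:E).

End weighted_mixed_norms.

(* Main.v *)
Require Import Defs.
From HB Require Import structures.
From mathcomp Require Import all_boot all_order all_algebra.
From mathcomp Require Import complex.
From mathcomp Require Import all_classical all_reals all_analysis.
From mathcomp Require Import measurable_realfun ring lra.
Set Implicit Arguments. Unset Strict Implicit. Unset Printing Implicit Defensive.
Import Order.TTheory GRing.Theory Num.Theory.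
Import numFieldNormedType.Exports.
Local Open Scope classical_set_scope.
Local Open Scope ring_scope.
Local Open Scope complex_scope.

(** A dilation sends an upper-tail potential to an upper-tail potential: if
    [g] is represented by [mu], then [dilate s g] is represented by the image
    of [mu] under [x |-> x / s].  Substituting in the two sides of the
    defining inequality of the class multiplies both of them by the same
    Jacobian [\prod_k (s k)^-1] and replaces [r] by [s * r], which is again an
    arbitrary positive vector; so the constants [K] and [lam] are preserved
    ([potential_mass_dilate], [integral_scale], [RMGM_dilate]).  The one
    delicate point is that the value of a complex Radon measure on an upper box
    is a limit along the exhaustion of the orthant by the cubes [[1/n, n]^d],
    and a dilation turns these cubes into other boxes.  Both exhaustions give
    the same limit because the finiteness of the potential mass makes the total
    variation of the upper box finite, so that the parts of the box outside
    either exhaustion have vanishing variation ([radon_ext_dilate]).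

    For the necessary condition, both norms are homogeneous under dilations.
    Coordinate by coordinate, [\|Pi_rho f_s\|_p] equals
    [\prod_k (s k)^(- rho k - 1/p k)] times [\|Pi_rho f\|_p]
    ([weighted_norm_scale]).  The Abel transform of [f_s] at [xi] is
    [\prod_k (s k)^-1] times that of [f] at [xi / s] ([abel_fourier_dilate]):
    substitute in the damped integral and note that [eps |-> eps / s] permutes
    the ways of tending to [0+].  Hence the transform side scales by
    [\prod_k (s k)^(-1 + alpha k + 1/q k)].  Taking [s] equal to [t] in the
    [k]-th coordinate and to [1] in the others, the assumed inequality bounds
    [t^(-1 + alpha k + 1/q k + rho k + 1/p k)] uniformly in [t > 0], which
    forces the exponent to vanish ([powR_bounded_eq0]).

    The Abel transform is a limit along a filter, and measurability of its
    partial norms would need a separate argument.  All substitutions are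
    therefore carried out for arbitrary functions: the integral of a
    nonnegative function is a supremum over the simple functions below it, and
    an invertible bimeasurable map transports these simple functions
    bijectively ([integral_bij]). *)

(** * Change of variables for lower integrals *)

Section change_of_variables.
Context {d1 d2 : measure_display} {R : realType}.
Context {T1 : measurableType d1} {T2 : measurableType d2}.
Local Open Scope ereal_scope.
Import HBNNSimple.

Section pullback.
Variables (phi : T1 -> T2) (k : R).
Hypotheses (mphi : measurable_fun setT phi) (k0 : (0 <= k)%R).
Variable h : {nnsfun T2 >-> R}.

Let pullback (x : T1) : R := (k * h (phi x))%R.

Let mpullback : measurable_fun setT pullback.
Proof.
apply: measurable_funM; first exact: measurable_cst.
by apply: measurableT_comp => //; exact: measurable_funPT.
Qed.
HB.instance Definition _ := isMeasurableFun.Build _ _ _ _ pullback mpullback.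

Let fpullback : finite_set (range pullback).
Proof.
apply: (@sub_finite_set _ _ ((fun y => k * y)%R @` range h)).
  by move=> _ [x _ <-]; exists (h (phi x)) => //; exists (phi x).
by apply: finite_image; exact: fimfunP.
Qed.
HB.instance Definition _ := FiniteImage.Build _ _ pullback fpullback.

Let pullback_ge0 x : (0 <= pullback x)%R.
Proof. by rewrite mulr_ge0. Qed.
HB.instance Definition _ := isNonNegFun.Build _ _ pullback pullback_ge0.

(** The composite of a simple function with a measurable map, times a
    constant, packaged as a simple function so that it can compete in the
    supremum that defines an integral. *)
Lemma nnsfun_pullback :
  exists h' : {nnsfun T1 >-> R}, forall x, h' x = (k * h (phi x))%R.
Proof. by exists pullback. Qed.
End pullback.

(** Every simple function below [f] pulls back to a simple function below [f
    \o phi], and its integral is multiplied by exactly [k * c]; taking suprema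
    gives one inequality, for an arbitrary nonnegative [f]. *)
Lemma le_integral_pullback (mu : {measure set T1 -> \bar R})
    (nu : {measure set T2 -> \bar R}) (phi : T1 -> T2) (k c : R)
    (f : T2 -> \bar R) :
  measurable_fun setT phi -> (0 < k)%R -> (0 < c)%R ->
  (forall A, measurable A -> mu (phi @^-1` A) = c%:E * nu A) ->
  (forall x, 0 <= f x) ->
  (k * c)%:E * \int[nu]_x f x <= \int[mu]_x (k%:E * f (phi x)).
Proof.
move=> mphi k0 c0 muE f0; have kc0 : (0 < k * c)%R by rewrite mulr_gt0.
rewrite -lee_pdivlMl// ge0_integralTE//; apply: ge_ereal_sup => _ [h /= hf <-].
rewrite lee_pdivlMl//.
have [h' h'E] := nnsfun_pullback mphi (ltW k0) h.
have [h1 h1E] := nnsfun_pullback mphi ler01 h.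
rewrite EFinM -muleA -!integralT_nnsfun.
have -> : c%:E * \int[nu]_x (h x)%:E = \int[mu]_x (h (phi x))%:E.
  under [in RHS]eq_integral do rewrite -[h _]mul1r -h1E.
  rewrite !integralT_nnsfun !sintegralET ge0_mule_fsumr; last first.
    by move=> r; exact: (nnsfun_mulemu_ge0 nu).
  apply: eq_fsbigr => r _; rewrite muleCA -muE//.
  by congr (_ * mu _); apply/funext => x /=; rewrite h1E mul1r.
rewrite (_ : k%:E * _ = \int[mu]_x (h' x)%:E); last first.
  under eq_integral do rewrite -[h _]mul1r -h1E.
  rewrite -ge0_integralZl//.
  - by apply: eq_integral => x _; rewrite h'E h1E mul1r EFinM.
  - by apply/measurable_EFinP; exact: measurable_funPT.
  - by move=> x _; rewrite lee_fin.
  - by rewrite lee_fin ltW.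
have kf0 x : 0 <= k%:E * f (phi x).
  by apply: mule_ge0 => //; rewrite lee_fin ltW.
rewrite [leRHS]ge0_integralTE// integralT_nnsfun.
apply: ereal_sup_ubound; exists h' => //= x.
by rewrite h'E EFinM lee_wpmul2l// lee_fin ltW.
Qed.

End change_of_variables.

(** Distributivity can fail in the extended reals when both terms are
    infinite; for a positive real factor both sides are then the same
    infinity. *)
Lemma pmuleBr (R : realType) (c : R) (a b : \bar R) :
  ((0 < c)%R -> 0 <= a -> 0 <= b -> c%:E * (a - b) = c%:E * a - c%:E * b)%E.
Proof.
case: b => [b||//] c0 a0 b0; first by rewrite muleBr// fin_num_adde_defl.
case: a a0 => [a||//] a0; first by rewrite muleBr// fin_num_adde_defr.
by rewrite /= gt0_muley ?gt0_muleNy ?lte_fin.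
Qed.

Section bijection.
Context {d1 d2 : measure_display} {R : realType}.
Context {T1 : measurableType d1} {T2 : measurableType d2}.
Local Open Scope ereal_scope.

Variables (mu : {measure set T1 -> \bar R}) (nu : {measure set T2 -> \bar R}).
Variables (phi : T1 -> T2) (psi : T2 -> T1) (c : R).
Hypotheses (mphi : measurable_fun setT phi) (mpsi : measurable_fun setT psi).
Hypotheses (phiK : cancel phi psi) (psiK : cancel psi phi) (c0 : (0 < c)%R).
Hypothesis mu_phi :
  forall A, measurable A -> mu (phi @^-1` A) = c%:E * nu A.

(** The reverse inequality is [le_integral_pullback] applied to the inverse
    map, the constants becoming [k^-1] and [c^-1]. *)
Lemma ge0_integral_bij (k : R) (f : T2 -> \bar R) :
  (0 < k)%R -> (forall x, 0 <= f x) ->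
  \int[mu]_x (k%:E * f (phi x)) = (k * c)%:E * \int[nu]_x f x.
Proof.
move=> k0 f0; apply/eqP; rewrite eq_le; apply/andP; split; last first.
  exact: le_integral_pullback.
have kc0 : (0 < k * c)%R by rewrite mulr_gt0.
rewrite -lee_pdivrMl//.
have nu_psi A : measurable A -> nu (psi @^-1` A) = (c^-1)%:E * mu A.
  move=> mA; have E : phi @^-1` (psi @^-1` A) = A.
    by apply/funext => x; rewrite /preimage/= phiK.
  rewrite -[in RHS]E mu_phi; last first.
    by rewrite -[X in measurable X]setTI; exact: mpsi.
  by rewrite muleA -EFinM mulVf ?gt_eqF// mul1e.
have ki0 : (0 < k^-1)%R by rewrite invr_gt0.
have ci0 : (0 < c^-1)%R by rewrite invr_gt0.
have h0 x : 0 <= k%:E * f (phi x) by apply: mule_ge0 => //; rewrite lee_fin ltW.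
have := le_integral_pullback mpsi ki0 ci0 nu_psi h0.
rewrite -invfM; congr (_ <= _); apply: eq_integral => x _.
by rewrite psiK muleA -EFinM mulVf ?gt_eqF// mul1e.
Qed.

Lemma integral_bij (D : set T2) (f : T2 -> \bar R) :
  \int[mu]_(x in phi @^-1` D) f (phi x) = c%:E * \int[nu]_(x in D) f x.
Proof.
rewrite integral_mkcond [in RHS]integral_mkcond.
set F := f \_ D.
have -> : (fun x => f (phi x)) \_ (phi @^-1` D) = F \o phi.
  by apply/funext => x; rewrite /F /patch/=; congr (if _ then _ else _).
rewrite integralE [in RHS]integralE.
have pos g : (forall x, 0 <= g x) ->
    \int[mu]_x g (phi x) = c%:E * \int[nu]_x g x.
  move=> g0; rewrite -[c]mul1r -ge0_integral_bij//.
  by apply: eq_integral => x _; rewrite mul1e.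
have -> : \int[mu]_x (F \o phi)^\+ x = c%:E * \int[nu]_x F^\+ x.
  rewrite -(pos (F^\+)) => [|x]; last exact: funepos_ge0.
  by apply: eq_integral => x _; rewrite !funeposE.
have -> : \int[mu]_x (F \o phi)^\- x = c%:E * \int[nu]_x F^\- x.
  rewrite -(pos (F^\-)) => [|x]; last exact: funeneg_ge0.
  by apply: eq_integral => x _; rewrite !funenegE.
by rewrite [RHS]pmuleBr// integral_ge0.
Qed.
End bijection.

(** Homogeneity of the integral as a supremum of simple integrals; it is the
    change of variables along the identity map. *)
Lemma ge0_integralZl_lower {d : measure_display} {R : realType}
    {T : measurableType d} (mu : {measure set T -> \bar R}) (D : set T) (k : R)
    (f : T -> \bar R) :
  0 < k -> (forall x, D x -> (0 <= f x)%E) ->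
  (\int[mu]_(x in D) (k%:E * f x) = k%:E * \int[mu]_(x in D) f x)%E.
Proof.
move=> k0 f0; rewrite integral_mkcond [in RHS]integral_mkcond.
have fD0 x : (0 <= (f \_ D) x)%E.
  by rewrite patchE; case: ifPn => // /set_mem; exact: f0.
have := @ge0_integral_bij _ _ _ _ _ mu mu id id 1 _ _ _ _ _ _ k _ k0 fD0.
rewrite mulr1 => <-//.
- apply: eq_integral => x _; rewrite !patchE.
  by case: ifPn => // _; rewrite mule0.
- by move=> A mA; rewrite mul1e.
Qed.

(** * Dilations of Lebesgue measure *)

Section dilation.
Context {R : realType}.

(** The measure [A |-> s * lebesgue_measure (s^-1 A)] gives every half-open
    interval its length, so it is Lebesgue measure by uniqueness. *)
Lemma lebesgue_measure_dilate (s : R) (A : set (measurableTypeR R)) :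
  0 < s -> measurable A ->
  (lebesgue_measure (( *%R s : measurableTypeR R -> measurableTypeR R) @^-1` A) =
   s^-1%:E * lebesgue_measure A)%E.
Proof.
move=> s0 mA.
have mf : measurable_fun setT ( *%R s : measurableTypeR R -> measurableTypeR R).
  exact: measurable_funM.
have s0' : 0 <= s by exact: ltW.
pose mu := mscale (NngNum s0') (pushforward (@lebesgue_measure R)
  ( *%R s : measurableTypeR R -> measurableTypeR R)).
suff -> : lebesgue_measure A = mu mf A.
  by rewrite /mu/mscale/= /pushforward muleA -EFinM mulVf ?gt_eqF// mul1e.
apply: lebesgue_measure_unique => // _ [[a b]] _ <-.
have E : ( *%R s : R -> R) @^-1` [set` `]a, b]] = [set` `]a / s, b / s]].
  by apply/seteqP; split => x /=;
    rewrite !in_itv/= ltr_pdivrMr// ler_pdivlMr// mulrC.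
transitivity (s%:E *
  lebesgue_measure (( *%R s : R -> R) @^-1` [set` `]a, b]]))%E; last by [].
rewrite E !lebesgue_measure_itv/= !lte_fin ltr_pM2r ?invr_gt0//.
case: ifPn => ab; last by rewrite mule0.
by rewrite -!EFinB -EFinM -mulrBl mulrCA mulfV ?gt_eqF// mulr1.
Qed.

Section scale.
Variable d : nat.
Implicit Types (s : 'I_d -> R) (x : point_of R d).

Lemma tnth_scale s x k : tnth (scale s x) k = s k * tnth x k.
Proof. by rewrite tnth_mktuple. Qed.

Lemma scaleK s : positive s -> cancel (scale s) (scale (fun k => (s k)^-1)).
Proof.
move=> s0 x; apply: eq_from_tnth => k.
by rewrite !tnth_scale mulKf// gt_eqF.
Qed.

Lemma scaleVK s : positive s -> cancel (scale (fun k => (s k)^-1)) (scale s).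
Proof.
move=> s0 x; apply: eq_from_tnth => k.
by rewrite !tnth_scale mulVKf// gt_eqF.
Qed.

Lemma positiveV s : positive s -> positive (fun k => (s k)^-1).
Proof. by move=> s0 k; rewrite invr_gt0. Qed.

Lemma measurable_scale s : measurable_fun setT (scale s).
Proof.
apply/measurable_fun_tnthP => k.
rewrite (_ : _ \o _ = fun x => s k * tnth x k); last first.
  by apply/funext => x /=; rewrite tnth_scale.
apply: measurable_funM; first exact: measurable_cst.
exact: measurable_tnth.
Qed.

Lemma measurable_preimage_scale s (A : set (point_of R d)) :
  measurable A -> measurable (scale s @^-1` A).
Proof.
by move=> mA; rewrite -[X in measurable X]setTI; exact: measurable_scale.
Qed.

Lemma scale_preimageVK s (A : set (point_of R d)) : positive s ->
  scale (fun k => (s k)^-1) @^-1` (scale s @^-1` A) = A.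
Proof. by move=> s0; apply/funext => x; rewrite /preimage/= scaleVK. Qed.

Lemma prodV_gt0 s : positive s -> 0 < \prod_k (s k)^-1.
Proof. by move=> s0; apply: prodr_gt0 => k _; rewrite invr_gt0. Qed.
End scale.

Lemma scale_cons_pair n (s : 'I_n.+1 -> R) (a : R) (y : point_of R n) :
  scale s (cons_pair (a, y)) =
  cons_pair (s ord0 * a, scale (fun k => s (lift ord0 k)) y).
Proof.
apply: eq_from_tnth => k; rewrite tnth_scale /cons_pair/=.
case: (unliftP ord0 k) => [j|] ->; last by rewrite !tnth0.
by rewrite !tnthS tnth_scale.
Qed.

(** Induction on the dimension: by slicing along the first coordinate, a
    section of the dilated set is a dilated section, and the remaining
    integral over the first coordinate is a one-dimensional substitution. *)
Lemma lebesgue_tuple_scale d (s : 'I_d -> R) (A : set (point_of R d)) :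
  positive s -> measurable A ->
  (lebesgue_tuple d (scale s @^-1` A) =
   (\prod_k (s k)^-1)%:E * lebesgue_tuple d A)%E.
Proof.
elim: d s A => [|n IH] s A s0 mA.
  rewrite big_ord0 mul1e; congr (lebesgue_tuple 0 _).
  by apply/funext => x; rewrite /preimage/=; congr (A _);
    apply: eq_from_tnth => -[].
pose s' (k : 'I_n) := s (lift ord0 k).
have s'0 : positive s' by move=> k; exact: s0.
pose B := @cons_pair R n @^-1` A.
have mB : measurable B.
  by rewrite -[X in measurable X]setTI; exact: measurable_cons_pair.
have E x : xsection (@cons_pair R n @^-1` (scale s @^-1` A)) x =
    scale s' @^-1` xsection B (s ord0 * x).
  by apply/seteqP; split => y /=; rewrite /xsection/= !inE/= scale_cons_pair.
transitivity (\int[@lebesgue_measure R]_x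
  lebesgue_tuple n (xsection (@cons_pair R n @^-1` (scale s @^-1` A)) x))%E.
  by [].
transitivity (\int[@lebesgue_measure R]_x
  ((\prod_k (s' k)^-1)%:E * lebesgue_tuple n (xsection B (s ord0 * x)%R)))%E.
  apply: eq_integral => x _.
  by rewrite E IH//; exact: measurable_xsection.
rewrite (@ge0_integral_bij _ _ _ _ _ lebesgue_measure lebesgue_measure
  ( *%R (s ord0)) ( *%R (s ord0)^-1) (s ord0)^-1 _ _ _ _ _ _ _
  (fun x => lebesgue_tuple n (xsection B x)))//.
- by rewrite big_ord_recl [in RHS]mulrC.
- by move=> x; rewrite mulKf// gt_eqF.
- by move=> x; rewrite mulVKf// gt_eqF.
- by rewrite invr_gt0.
- by move=> C mC; exact: lebesgue_measure_dilate.
- exact: prodV_gt0.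
Qed.

Lemma integral_scale d (s : 'I_d -> R) (D : set (point_of R d))
    (f : point_of R d -> \bar R) : positive s ->
  (\int[lebesgue_tuple d]_(x in scale s @^-1` D) f (scale s x) =
   (\prod_k (s k)^-1)%:E * \int[lebesgue_tuple d]_(x in D) f x)%E.
Proof.
move=> s0; apply: (integral_bij (@measurable_scale _ s) (@measurable_scale _ _)
  (scaleK s0) (scaleVK s0) (prodV_gt0 s0)) => A mA.
exact: lebesgue_tuple_scale.
Qed.

(** The real-valued integral is the finite part of the extended one, and
    multiplication by a positive real preserves the convention that an
    infinite value has finite part 0. *)
Lemma Rintegral_scale d (s : 'I_d -> R) (f : point_of R d -> R) : positive s ->
  \int[lebesgue_tuple d]_x f (scale s x) =
   (\prod_k (s k)^-1) * \int[lebesgue_tuple d]_x f x.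
Proof.
move=> s0; rewrite /Rintegral -[setT in LHS](preimage_setT (scale s)).
rewrite (integral_scale setT (fun x => (f x)%:E) s0).
have := prodV_gt0 s0; set c := \prod_k _ => c0.
case: (integral _ _ _) => [r||] //=.
  by rewrite gt0_muley ?lte_fin//= mulr0.
by rewrite gt0_muleNy ?lte_fin//= mulr0.
Qed.

Lemma lebesgue_tuple_hyperplane d (k : 'I_d) :
  lebesgue_tuple d [set x : point_of R d | tnth x k = 0] = 0%E.
Proof.
elim: d k => [[]//|n IH] k.
transitivity (\int[@lebesgue_measure R]_x lebesgue_tuple n
  (xsection (@cons_pair R n @^-1`
    [set x : point_of R n.+1 | tnth x k = 0%R]) x))%E; first by [].
case: (unliftP ord0 k) => [j|] ->.
  rewrite integral0_eq// => x _.
  rewrite -[RHS](IH j); congr (lebesgue_tuple n _).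
  by apply/seteqP; split => y /=; rewrite /xsection/= !inE/= tnthS.
transitivity (\int[@lebesgue_measure R]_(x in [set 0%R])
    lebesgue_tuple n setT)%E; last first.
  by rewrite integral_set1.
rewrite [RHS]integral_mkcond; apply: eq_integral => x _; rewrite patchE.
case: ifPn => [/set_mem/= x0|/negP x0].
  congr (lebesgue_tuple n _).
  by apply/seteqP; split => y /=; rewrite /xsection/= !inE/= tnth0.
rewrite -[RHS](measure0 (lebesgue_tuple n)); congr (lebesgue_tuple n _).
by apply/seteqP; split => y //=; rewrite /xsection/= !inE/= tnth0.
Qed.

End dilation.

(** * Dilations of complex Radon measures *)

Section row_scale.
Context {R : realType} {d : nat}.
Implicit Types (s : 'I_d -> R).

(** The dilation on row vectors, where the topology lives: compactness of
    subsets of the orthant and the filter of damping parameters both refer to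
    row vectors. *)
Definition row_scale s (v : 'rV[R]_d) : 'rV[R]_d := \row_k (s k * v ord0 k).

Lemma row_scale_continuous s : continuous (row_scale s).
Proof.
move=> v A [P Pv PA].
exists (fun i k => ( *%R (s k)) @^-1` P i k).
  move=> i k; rewrite (ord1 i).
  have := Pv ord0 k; rewrite /row_scale mxE => h.
  exact: (@mulrl_continuous _ (s k) (v ord0 k) _ h).
move=> w /= Pw; apply: PA => i k /=; rewrite mxE.
by have := Pw i k; rewrite /= (ord1 i).
Qed.

Lemma row_scaleK s : positive s ->
  cancel (row_scale s) (row_scale (fun k => (s k)^-1)).
Proof.
by move=> s0 v; apply/rowP => k; rewrite !mxE ord1 mulKf// gt_eqF.
Qed.

Lemma row_of_scale s x : row_of (scale s x) = row_scale s (row_of x).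
Proof. by apply/rowP => k; rewrite !mxE tnth_scale. Qed.

Lemma orthant_scale s x :
  positive s -> orthant R d (scale s x) <-> orthant R d x.
Proof.
by move=> s0; split=> xo k; have := xo k; rewrite tnth_scale pmulr_rgt0.
Qed.

Lemma preimage_scale_orthant s :
  positive s -> scale s @^-1` orthant R d = orthant R d.
Proof. by move=> s0; apply/seteqP; split => x /=; rewrite orthant_scale. Qed.

Lemma relatively_compact_scale s (A : set (point_of R d)) : positive s ->
  relatively_compact A -> relatively_compact (scale s @^-1` A).
Proof.
move=> s0 [K [cK Ko] AK].
exists (scale s @^-1` K); last by move=> x /AK.
split; last by move=> x /= /Ko; rewrite orthant_scale.
rewrite (_ : _ @` _ = row_scale (fun k => (s k)^-1) @` (row_of @` K)).
  apply: continuous_compact => //; apply: continuous_subspaceT.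
  exact: row_scale_continuous.
apply/seteqP; split => [_ [x Kx <-]|_ [_ [x Kx <-] <-]] /=.
  exists (row_of (scale s x)); first by exists (scale s x).
  by rewrite row_of_scale row_scaleK.
by exists (scale (fun k => (s k)^-1) x); rewrite ?scaleVK// row_of_scale.
Qed.
End row_scale.

Section radon_dilate.
Context {R : realType} {d : nat}.
Variables (s : 'I_d -> R) (s0 : positive s) (mu : complex_radon R d).
Let sV : 'I_d -> R := fun k => (s k)^-1.
Let sV0 : positive sV. Proof. exact: positiveV. Qed.

Let val (A : set (point_of R d)) : R[i] := mu (scale sV @^-1` A).

(** Finite families of disjoint sets in [A] and in its image under the
    dilation correspond bijectively, with the same sums. *)
Lemma complex_variation_scale (A : set (point_of R d)) :
  complex_variation val A = radon_variation mu (scale sV @^-1` A).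
Proof.
congr (ereal_sup _); apply/seteqP; split => _ [F [n [FA tF ->]]].
  exists (fun i => scale sV @^-1` F i), n; split => // [i|].
    have [mF cF FiA] := FA i; split; first exact: measurable_preimage_scale.
      exact: relatively_compact_scale.
    by move=> x /FiA.
  by move=> i j _ _ [x [Fi Fj]]; apply: tF => //; exists (scale sV x).
exists (fun i => scale s @^-1` F i), n; split => // [i||].
- have [mF cF FiA] := FA i; split; first exact: measurable_preimage_scale.
    exact: relatively_compact_scale.
  by move=> x /FiA; rewrite /= /sV scaleK.
- by move=> i j _ _ [x [Fi Fj]]; apply: tF => //; exists (scale s x).
- by congr EFin; apply: eq_bigr => i _; rewrite /val scale_preimageVK.
Qed.

Let val_additive : forall F : (set (point_of R d))^nat,
    (forall n, measurable (F n)) -> trivIset setT F ->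
    relatively_compact (\bigcup_n F n) ->
    (fun n => \sum_(i < n) val (F i)) @ \oo -->
      (val (\bigcup_n F n) : R[i]^o).
Proof.
move=> F mF tF cF; rewrite /val preimage_bigcup; apply: radon_additive.
- by move=> n; exact: measurable_preimage_scale.
- by move=> i j _ _ [x [Fi Fj]]; apply: tF => //; exists (scale sV x).
- by rewrite -preimage_bigcup; exact: relatively_compact_scale.
Qed.

Let val_locally_finite : forall K,
    compact_in_orthant K -> (complex_variation val K < +oo)%E.
Proof.
move=> K cK; rewrite complex_variation_scale.
have [K' cK' KK'] : relatively_compact (scale sV @^-1` K).
  by apply: relatively_compact_scale => //; exists K.
apply: le_lt_trans (radon_locally_finite mu cK').
apply: ge_ereal_sup => _ [F [n [FA tF ->]]].
apply: ereal_sup_ubound; exists F, n; split=> // i.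
by have [? ? FiA] := FA i; split=> //; exact: subset_trans KK'.
Qed.

Definition radon_dilate : complex_radon R d :=
  ComplexRadon val_additive val_locally_finite.

Lemma radon_dilateE A : radon_dilate A = mu (scale sV @^-1` A).
Proof. by []. Qed.

(** The variation of the dilated measure is the image of the variation of
    [mu], so this is the change of variables with constant 1. *)
Lemma integral_radon_dilate (D : set (point_of R d))
    (f : point_of R d -> \bar R) :
  (\int[radon_variation radon_dilate]_(x in D) f x =
   \int[radon_variation mu]_(x in scale sV @^-1` D) f (scale sV x))%E.
Proof.
rewrite (integral_bij (measurable_scale sV) (measurable_scale s)
  (scaleVK s0) (scaleK s0) ltr01
  (mu := radon_variation mu) (nu := radon_variation radon_dilate)).
  by rewrite mul1e.
by move=> A mA; rewrite mul1e; exact/esym/complex_variation_scale.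
Qed.

(** After substitution the integrand is a product of [min (r, t / s)], and
    [min (r, t / s) = min (s * r, t) / s] in each coordinate. *)
Lemma potential_mass_dilate (r : 'I_d -> R) : positive r ->
  (potential_mass radon_dilate r =
   (\prod_k (s k)^-1)%:E * potential_mass mu (fun k => s k * r k)%R)%E.
Proof.
move=> r0; rewrite /potential_mass integral_radon_dilate.
rewrite preimage_scale_orthant//.
rewrite -ge0_integralZl_lower; first last.
- move=> x xo; rewrite lee_fin; apply: prodr_ge0 => k _.
  by rewrite le_min; apply/andP; split; rewrite ltW// mulr_gt0.
- exact: prodV_gt0.
apply: eq_integral => x _; rewrite -EFinM -big_split/=; congr EFin.
apply: eq_bigr => k _; rewrite tnth_scale minr_pMr ?invr_ge0 ?ltW//.
by rewrite mulKf// gt_eqF.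
Qed.

End radon_dilate.

(** * Upper tails of a dilated Radon measure *)

Section radon_theory.
Context {R : realType} {d : nat}.
Implicit Types (mu : complex_radon R d) (A B : set (point_of R d)).

Lemma normc_radon_le mu A : measurable A -> relatively_compact A ->
  ((Normc.normc (mu A))%:E <= radon_variation mu A)%E.
Proof.
move=> mA cA; apply: ereal_sup_ubound.
exists (fun i => if i == 0%N then A else set0), 1%N.
split=> [i||]; last by rewrite big_ord1.
  case: ifP => _; split => //.
  exact: relatively_compact0.
by move=> [|i] [|j] _ _ //= [x []].
Qed.

Lemma radonU mu A B : measurable A -> measurable B ->
  relatively_compact (A `|` B) -> A `&` B = set0 -> mu (A `|` B) = mu A + mu B.
Proof.
move=> mA mB cAB AB0.
have mF n : measurable (bigcup2 A B n).
  by case: n => [|[|n]]; rewrite /bigcup2/=.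
have tF : trivIset setT (bigcup2 A B).
  by move=> [|[|i]] [|[|j]] _ _; rewrite /bigcup2/= => -[x []] // Ax Bx;
    have : set0 x by rewrite -AB0.
have := @radon_additive _ _ mu _ mF tF; rewrite bigcup2E => /(_ cAB) h.
have h2 : (fun n => \sum_(i < n) mu (bigcup2 A B i) : R[i]^o) @ \oo -->
    (mu A + mu B : R[i]^o).
  (* the partial sums are constant from the second one on *)
  rewrite -(cvg_shiftn 2%N) /=.
  have cst : (fun=> mu A + mu B : R[i]^o) @ \oo --> (mu A + mu B : R[i]^o).
    by apply: cvg_cst.
  apply: cvg_trans cst.
  apply: near_eq_cvg; apply: nearW => n.
  rewrite addn2 !big_ord_recl /= big1 ?addr0// => i _.
  exact: radon_val0.
exact: (cvg_unique (@norm_hausdorff _ R[i]^o) h h2).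
Qed.

(** The common part [A `&` B] cancels. This is how two exhaustions of the same
    set are compared. *)
Lemma normc_radonB_le mu A B : measurable A -> measurable B ->
  relatively_compact A -> relatively_compact B ->
  ((Normc.normc (mu A - mu B))%:E <=
   radon_variation mu (A `\` B) + radon_variation mu (B `\` A))%E.
Proof.
move=> mA mB cA cB.
have AE C D : measurable C -> measurable D -> relatively_compact C ->
    mu C = mu (C `&` D) + mu (C `\` D).
  move=> mC mD cC; rewrite -radonU ?setUIDK//.
  - exact: measurableI.
  - exact: measurableD.
  - by rewrite setDE setIACA setICr setI0.
rewrite (AE A B)// (AE B A)// [B `&` A]setIC opprD addrACA subrr add0r.
apply: (@le_trans _ _ ((Normc.normc (mu (A `\` B)))%:E +
                       (Normc.normc (mu (B `\` A)))%:E)%E).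
  rewrite -EFinD lee_fin -[in leRHS](normcN (mu (B `\` A))).
  exact: le_normcD.
by apply: leeD; apply: normc_radon_le; (try exact: measurableD);
  apply: relatively_compactS (@subDsetl _ _ _) _.
Qed.

Lemma exhaustion_orthant n : exhaustion n `<=` orthant R d.
Proof.
by move=> x En k; have /andP[+ _] := En k; apply: lt_le_trans; rewrite invr_gt0.
Qed.

Lemma measurable_forall (P : 'I_d -> set R) :
  (forall k, measurable (P k : set (measurableTypeR R))) ->
  measurable [set x : point_of R d | forall k, P k (tnth x k)].
Proof.
move=> mP; rewrite (_ : mkset _ = \bigcap_(k in [set: 'I_d])
    ((fun x : point_of R d => tnth x k) @^-1` P k)); last first.
  by apply/seteqP; split => [x h k _|x h k] /=; [exact: h|exact: (h k)].
apply: fin_bigcap_measurable => // k _.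
by rewrite -[X in measurable X]setTI; apply: measurable_tnth.
Qed.

Lemma measurable_exhaustion n : measurable (exhaustion n : set (point_of R d)).
Proof.
apply: (@measurable_forall (fun=> [set y | n.+1%:R^-1 <= y <= n.+1%:R])) => k.
rewrite (_ : mkset _ = [set` `[n.+1%:R^-1, n.+1%:R]]).
  exact: measurable_itv.
by apply/seteqP; split => y /=; rewrite in_itv.
Qed.

Lemma measurable_upper_box x : measurable (upper_box x : set (point_of R d)).
Proof.
apply: (@measurable_forall (fun k => [set y | tnth x k <= y])) => k.
rewrite (_ : mkset _ = [set` `[tnth x k, +oo[]); first exact: measurable_itv.
by apply/seteqP; split => y /=; rewrite in_itv/= andbT.
Qed.

Lemma measurable_orthant : measurable (orthant R d).
Proof.
apply: (@measurable_forall (fun=> [set y | 0 < y])) => k.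
rewrite (_ : mkset _ = [set` `]0%R, +oo[]); first exact: measurable_itv.
by apply/seteqP; split => y /=; rewrite in_itv/= andbT.
Qed.

Lemma relatively_compact_exhaustion n :
  relatively_compact (exhaustion n : set (point_of R d)).
Proof.
exists (exhaustion n) => //; split; last exact: exhaustion_orthant.
have := @rV_compact R d (fun=> [set` `[n.+1%:R^-1, n.+1%:R]]).
move=> /(_ (fun _ => @segment_compact _ _ _)); congr compact.
apply/seteqP; split => [v vE|_ [x Ex <-] k].
  exists [tuple v ord0 k | k < d].
    by move=> k; rewrite tnth_mktuple; have := vE k; rewrite /= in_itv.
  by apply/rowP => k; rewrite mxE tnth_mktuple.
by rewrite /= in_itv/= mxE; exact: Ex.
Qed.

Lemma exhaustion_nondecreasing :
  nondecreasing_seq (exhaustion : nat -> set (point_of R d)).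
Proof.
move=> m n mn; apply/subsetPset => x xm k; have /andP[h1 h2] := xm k.
apply/andP; split; last by apply: le_trans h2 _; rewrite ler_nat.
by apply: le_trans h1; rewrite lef_pV2 ?posrE// ler_nat.
Qed.

(** A single index must serve all coordinates: the sum of all coordinates and
    their inverses dominates each of them. *)
Lemma bigcup_exhaustion : \bigcup_n exhaustion n = orthant R d.
Proof.
apply/seteqP; split => [x [n _]|x xo]; first exact: exhaustion_orthant.
pose M := \sum_k (tnth x k + (tnth x k)^-1).
exists (Num.truncn M) => // k.
have xk := xo k.
have kM : tnth x k + (tnth x k)^-1 <= (Num.truncn M).+1%:R.
  apply: le_trans (ltW (truncnS_gt M)).
  rewrite /M (bigD1 k)//= lerDl; apply: sumr_ge0 => i _.
  by rewrite addr_ge0// ?invr_ge0 ltW// xo.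
apply/andP; split.
  rewrite -[leRHS]invrK lef_pV2 ?posrE ?invr_gt0//; apply: le_trans kM.
  by rewrite lerDr ltW.
by apply: le_trans kM; rewrite lerDl invr_ge0 ltW.
Qed.

(** Above [x] each factor [min (x k, t k)] of the integrand equals [x k]. *)
Lemma potential_mass_upper_box mu x : orthant R d x ->
  ((\prod_k tnth x k)%:E * radon_variation mu (upper_box x) <=
   potential_mass mu (fun k => tnth x k))%E.
Proof.
move=> xo; rewrite -integral_cst//; last exact: measurable_upper_box.
rewrite /potential_mass.
have mo : measurable (orthant R d) by exact: measurable_orthant.
have uo : upper_box x `<=` orthant R d.
  by move=> y xy k; apply: lt_le_trans (xy k); exact: xo.
have mf D : measurable_fun D
    (fun t : point_of R d => (\prod_k Num.min (tnth x k) (tnth t k))%:E).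
  apply/measurable_EFinP/measurable_funTS/measurable_prod => k _.
  by apply: measurable_minr => //; exact: measurable_tnth.
have f0 y : orthant R d y ->
    (0 <= (\prod_k Num.min (tnth x k) (tnth y k))%:E)%E.
  move=> yo; rewrite lee_fin; apply: prodr_ge0 => k _.
  by rewrite le_min; apply/andP; split; apply: ltW; [exact: xo|exact: yo].
apply: (@le_trans _ _ (\int[radon_variation mu]_(t in upper_box x)
    (\prod_(k < d) Num.min (tnth x k) (tnth t k))%:E)%E).
  apply: ge0_le_integral => //.
  - exact: measurable_upper_box.
  - by move=> y _; rewrite lee_fin; apply: prodr_ge0 => k _; exact: ltW.
  - move=> y xy; rewrite lee_fin; apply: ler_prod => k _.
    by rewrite ltW//= le_min lexx/=; exact: xy.
apply: ge0_subset_integral => //; exact: measurable_upper_box.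
Qed.

Lemma radon_variation_upper_box mu x :
  (forall r, positive r -> (potential_mass mu r < +oo)%E) -> orthant R d x ->
  (radon_variation mu (upper_box x) < +oo)%E.
Proof.
move=> mu_fin xo; have := potential_mass_upper_box mu xo.
have p0 : 0 < \prod_k tnth x k by apply: prodr_gt0 => k _; exact: xo.
move=> /le_lt_trans /(_ (mu_fin _ xo)).
have : (0 <= radon_variation mu (upper_box x))%E by [].
case: (radon_variation mu (upper_box x)) => [r _ _|_|//]; first exact: ltry.
by rewrite gt0_muley ?lte_fin.
Qed.

Lemma variation_tail_cvg0 mu A (E : (set (point_of R d))^nat) :
  measurable A -> (radon_variation mu A < +oo)%E ->
  (forall n, measurable (E n)) -> nondecreasing_seq E -> A `<=` \bigcup_n E n ->
  (fun n => radon_variation mu (A `\` E n)) @ \oo --> 0%E.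
Proof.
move=> mA Afin mE ndE AE.
have I0 : \bigcap_n (A `\` E n) = set0.
  rewrite -subset0 => x h; have [Ax _] := h 0%N I.
  by have [n _ En] := AE x Ax; have [_] := h n I.
rewrite -(measure0 (radon_variation mu)) -I0.
apply: (nonincreasing_cvg_mu (mu := radon_variation mu)).
- apply: le_lt_trans Afin; apply: le_measure; rewrite ?inE//.
  exact: measurableD.
- by move=> n; exact: measurableD.
- by rewrite I0.
- move=> m n mn; apply/subsetPset => x [Ax nEx]; split => // Emx; apply: nEx.
  by have /subsetPset := ndE _ _ mn; apply.
Qed.

(** Stated in an abstract normed group, where unification is not tempted to
    unfold the complex numbers. *)
Lemma cvg_congr (V : pseudoMetricNormedZmodType R[i]) (u v : nat -> V) (l : V) :
  (fun n => u n - v n) @ \oo --> (0 : V) -> u @ \oo --> l <-> v @ \oo --> l.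
Proof.
move=> uv; split => h.
  rewrite -[l]subr0 (_ : v = u - (fun n => u n - v n)); first exact: cvgB.
  by apply/funext => n; rewrite !fctE opprB addrC subrK.
rewrite -[l]addr0 (_ : u = v + (fun n => u n - v n)); first exact: cvgD.
by apply/funext => n; rewrite !fctE addrC subrK.
Qed.

(** Two sequences with vanishing difference have the same set of limits, hence
    the same chosen limit, whether or not they converge. *)
Lemma lim_congr (u v : nat -> R[i]^o) :
  (fun n => u n - v n) @ \oo --> (0 : R[i]^o) -> lim (u @ \oo) = lim (v @ \oo).
Proof.
move=> uv; congr get; apply/funext => l; apply/propext.
exact: (@cvg_congr R[i]^o u v l uv).
Qed.

Lemma normc_cvg0 (u : nat -> R[i]^o) (b : nat -> \bar R) :
  (forall n, ((Normc.normc (u n))%:E <= b n)%E) -> b @ \oo --> 0%E ->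
  u @ \oo --> (0 : R[i]^o).
Proof.
move=> ub b0; apply/cvgr0Pnorm_lt => -[e e'] /=.
rewrite ltcE/= => /andP[/eqP -> e0].
have h : nbhs (0%E : \bar R) [set y | (y < e%:E)%E].
  exact: (open_nbhs_nbhs (conj (@open_ereal_lt_ereal _ _) _)).
have [N _ bN] := b0 _ h; exists N => // n /bN/= bn.
have := le_lt_trans (ub n) bn; rewrite lte_fin.
by rewrite -ltcR.
Qed.

(** Both sides are limits of [mu] on the upper box at [scale s x] cut by an
    exhaustion of the orthant: by dilated cubes on the left, by cubes on the
    right. The difference of the two values is bounded by the variation of the
    box outside each exhaustion, which tends to 0 since the variation of the
    box is finite. *)
Lemma radon_ext_dilate mu (s : 'I_d -> R) (s0 : positive s) x :
  (forall r, positive r -> (potential_mass mu r < +oo)%E) -> orthant R d x ->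
  radon_ext (radon_dilate s0 mu) (upper_box x) =
  radon_ext mu (upper_box (scale s x)).
Proof.
move=> mu_fin xo; rewrite /radon_ext; set A := upper_box (scale s x).
pose sV k := (s k)^-1.
have sV0 : positive sV by exact: positiveV.
pose P n := scale sV @^-1` exhaustion n.
have AE : scale sV @^-1` upper_box x = A.
  by apply/seteqP; split => y xy k; have := xy k;
    rewrite !tnth_scale /sV ler_pdivlMl.
have sxo : orthant R d (scale s x) by rewrite orthant_scale.
have Ao : A `<=` orthant R d.
  by move=> y xy k; apply: lt_le_trans (xy k); exact: sxo.
have mA : measurable A by exact: measurable_upper_box.
have Afin := radon_variation_upper_box mu_fin sxo.
have mE := measurable_exhaustion.
have mP n : measurable (P n) by exact: measurable_preimage_scale.
have mAP n : measurable (A `&` P n) by apply: measurableI => //; exact: mP.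
have mAE n : measurable (A `&` exhaustion n).
  by apply: measurableI => //; exact: mE.
apply: lim_congr.
apply: (@normc_cvg0 _ (fun n => radon_variation mu (A `\` exhaustion n) +
                        radon_variation mu (A `\` P n))%E).
  move=> n; rewrite radon_dilateE preimage_setI AE.
  apply: le_trans (normc_radonB_le mu _ _ _ _) _.
  - exact: mAP.
  - exact: mAE.
  - apply: relatively_compactS (@subIsetr _ _ _) _.
    apply: relatively_compact_scale => //.
    exact: relatively_compact_exhaustion.
  - apply: relatively_compactS (@subIsetr _ _ _) _.
    exact: relatively_compact_exhaustion.
  apply: leeD; apply: le_measure; rewrite ?inE.
  - exact: measurableD (mAP n) (mAE n).
  - exact: measurableD mA (mE n).
  - by move=> y [[Ay _] nE]; split => // Ey; apply: nE.
  - exact: measurableD (mAE n) (mAP n).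
  - exact: measurableD mA (mP n).
  - by move=> y [[Ay _] nE]; split => // Ey; apply: nE.
rewrite -[0%E]adde0; apply: cvgeD => //.
  apply: variation_tail_cvg0 => //; first exact: exhaustion_nondecreasing.
  by rewrite bigcup_exhaustion.
apply: variation_tail_cvg0 => //.
  move=> m n mn; apply/subsetPset => y.
  by have /subsetPset := exhaustion_nondecreasing mn; apply.
by rewrite -preimage_bigcup bigcup_exhaustion preimage_scale_orthant.
Qed.

End radon_theory.

(** * Dilation invariance of the class *)

Section RMGM_dilate.
Context {R : realType} {d : nat}.
Variables (s : 'I_d -> R) (s0 : positive s).

Lemma cmeasurable_dilate (D : set (point_of R d)) g : measurable D ->
  cmeasurable_fun D g -> cmeasurable_fun (scale s @^-1` D) (dilate s g).
Proof.
move=> mD [mRe mIm]; split.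
  apply: (measurable_comp mD _ mRe); first by move=> _ [x Dx <-].
  by apply: measurable_funTS; exact: measurable_scale.
apply: (measurable_comp mD _ mIm); first by move=> _ [x Dx <-].
by apply: measurable_funTS; exact: measurable_scale.
Qed.

Lemma ae_scale (P : point_of R d -> Prop) :
  {ae lebesgue_tuple d, forall x, P x} ->
  {ae lebesgue_tuple d, forall x, P (scale s x)}.
Proof.
move=> [A [mA A0 PA]]; exists (scale s @^-1` A); split.
- exact: measurable_preimage_scale.
- by rewrite lebesgue_tuple_scale// [X in (_ * X)%E]A0 mule0.
- by move=> x nP; exact: PA.
Qed.

Lemma positiveM (r : 'I_d -> R) : positive r -> positive (fun k => s k * r k).
Proof. by move=> r0 k; rewrite mulr_gt0. Qed.

Lemma potential_mass_dilate_lty mu :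
  (forall r, positive r -> (potential_mass mu r < +oo)%E) ->
  forall r, positive r -> (potential_mass (radon_dilate s0 mu) r < +oo)%E.
Proof.
move=> mu_fin r r0; rewrite potential_mass_dilate//.
have := mu_fin _ (positiveM r0).
have : (0 <= potential_mass mu (fun k => s k * r k)%R)%E.
  apply: integral_ge0 => t to; rewrite lee_fin; apply: prodr_ge0 => k _.
  by rewrite le_min; apply/andP; split; apply: ltW; rewrite ?mulr_gt0.
case: (potential_mass _ _) => // m _ _.
by rewrite -EFinM ltry.
Qed.

Lemma upper_tail_measure_dilate g mu :
  upper_tail_measure g mu ->
  upper_tail_measure (dilate s g) (radon_dilate s0 mu).
Proof.
move=> [mu_fin gE]; split; first exact: potential_mass_dilate_lty.
apply: filterS (ae_scale gE) => x gx xo.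
by rewrite radon_ext_dilate// /dilate gx// orthant_scale.
Qed.

Lemma canonical_version_dilate g :
  canonical_version g -> canonical_version (dilate s g).
Proof.
move=> [mu gmu gE]; exists (radon_dilate s0 mu).
  exact: upper_tail_measure_dilate.
have [mu_fin _] := gmu.
by move=> x xo; rewrite radon_ext_dilate// /dilate gE// orthant_scale.
Qed.

Lemma open_box_scale r :
  scale s @^-1` open_box (fun k => s k * r k) = open_box r.
Proof.
by apply/seteqP; split => x xr k; have := xr k;
  rewrite tnth_scale pmulr_rgt0// ltr_pM2l.
Qed.

(** Both sides of the inequality at [r] for the dilated potential are [\prod_k
    (s k)^-1] times the sides at [s * r] for [g]. *)
Lemma RMGM_dilate K lam g : RMGM K lam g -> RMGM K lam (dilate s g).
Proof.
move=> [mg [mu gmu gK]]; split.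
  rewrite -(preimage_scale_orthant s0); apply: cmeasurable_dilate => //.
  exact: measurable_orthant.
exists (radon_dilate s0 mu); first exact: upper_tail_measure_dilate.
move=> r r0; rewrite potential_mass_dilate//.
rewrite -(open_box_scale (fun k => lam k * r k)).
rewrite (integral_scale _ (fun x => (Normc.normc (g x))%:E) s0).
rewrite muleCA; apply: lee_wpmul2l; first by rewrite lee_fin ltW// prodV_gt0.
rewrite (_ : (fun k => s k * (lam k * r k)) = (fun k => lam k * (s k * r k))).
  exact: gK (positiveM r0).
by apply/funext => k; rewrite mulrCA.
Qed.

End RMGM_dilate.

(** * Dilations and weighted mixed norms *)

Section norms.
Context {R : realType}.

(** The substitution produces the Jacobian [s^-1] under the power [p^-1]. *)
Lemma Lnorm_dilate (p c s : R) (F : measurableTypeR R -> \bar R) :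
  0 < p -> 0 < c -> 0 < s ->
  (Lnorm (@lebesgue_measure R) p%:E (fun t => c%:E * F (s * t)%R) =
   (c * s `^ (- p^-1))%:E * Lnorm (@lebesgue_measure R) p%:E F)%E.
Proof.
move=> p0 c0 s0; rewrite unlock.
pose G t := (`|F t| `^ p)%E.
have cp0 : 0 < c `^ p by rewrite powR_gt0.
have G0 t : (0 <= G t)%E by exact: poweR_ge0.
transitivity
  ((\int[@lebesgue_measure R]_t ((c `^ p)%:E * G (s * t)%R)) `^ p^-1)%E.
  congr (_ `^ _)%E; apply: eq_integral => t _.
  by rewrite abseM poweRM ?abse_ge0//= gtr0_norm.
rewrite (@ge0_integral_bij _ _ _ _ _ lebesgue_measure lebesgue_measure
  ( *%R s) ( *%R s^-1) s^-1)//; last 4 first.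
- by move=> x; rewrite mulKf// gt_eqF.
- by move=> x; rewrite mulVKf// gt_eqF.
- by rewrite invr_gt0.
- by move=> C mC; exact: lebesgue_measure_dilate.
rewrite poweRM; last 2 first.
- by rewrite lee_fin mulr_ge0 ?invr_ge0// ltW.
- by apply: integral_ge0 => t _.
congr (_ * _)%E; rewrite poweR_EFin; congr EFin.
rewrite powRM ?powR_ge0 ?invr_ge0 ?(ltW s0)//.
rewrite -powRrM mulfV ?gt_eqF// powRr1 ?ltW//.
by rewrite -powR_inv1 ?ltW// -powRrM mulN1r.
Qed.

(** The innermost norm contributes the factor of the first coordinate and
    leaves a function of the remaining variables, dilated by the remaining
    coordinates of [s]; the accumulated constant [c] makes the induction go
    through. *)
Lemma mixed_norm_scale d (p s : 'I_d -> R) (c : R)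
    (F : point_of R d -> \bar R) :
  (forall k, 0 < p k) -> positive s -> 0 < c ->
  (mixed_norm p (fun x => c%:E * F (scale s x)) =
   (c * \prod_k s k `^ (- (p k)^-1))%:E * mixed_norm p F)%E.
Proof.
elim: d p s c F => [|n IH] p s c F p0 s0 c0 /=.
  rewrite big_ord0 mulr1; congr (_ * F _)%E.
  by apply: eq_from_tnth => -[].
pose s' k := s (lift ord0 k).
have s'0 : positive s' by move=> k; exact: s0.
pose G y := Lnorm (@lebesgue_measure R) (p ord0)%:E
              (fun t => F (cons_pair (t, y))).
transitivity (mixed_norm (fun k => p (lift ord0 k)) (fun y : point_of R n =>
   (c * s ord0 `^ (- (p ord0)^-1))%:E * G (scale s' y))%E).
  congr (mixed_norm _ _); apply/funext => y.
  rewrite -(Lnorm_dilate (fun t => F (cons_pair (t, scale s' y))))//.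
  by congr (Lnorm _ _ _); apply/funext => t; rewrite scale_cons_pair.
rewrite IH//; last by rewrite mulr_gt0// powR_gt0.
by rewrite big_ord_recl mulrA.
Qed.

Lemma off_hyperplanes_scale d (s : 'I_d -> R) (x : point_of R d) :
  positive s -> off_hyperplanes (scale s x) = off_hyperplanes x.
Proof.
move=> s0; apply: eq_forallb => k.
by rewrite tnth_scale mulf_eq0 gt_eqF.
Qed.

Lemma weight_scale d (s rho : 'I_d -> R) (x : point_of R d) : positive s ->
  weight rho (scale s x) = (\prod_k s k `^ rho k) * weight rho x.
Proof.
move=> s0; rewrite /weight off_hyperplanes_scale//.
case: ifP => _; last by rewrite mulr0.
rewrite -big_split/=; apply: eq_bigr => k _.
by rewrite tnth_scale normrM gtr0_norm// powRM// ltW.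
Qed.

(** The weight vanishes on the coordinate hyperplanes, so a relation between
    [G] and [F] off them becomes an identity of weighted functions everywhere. *)
Lemma weighted_norm_scale d (p rho s : 'I_d -> R) (c : R)
    (F G : point_of R d -> R[i]) :
  (forall k, 0 < p k) -> positive s -> 0 < c ->
  (forall x, off_hyperplanes x -> G x = c%:C * F (scale s x)) ->
  (weighted_norm p rho G =
   (c * \prod_k s k `^ (- rho k - (p k)^-1))%:E * weighted_norm p rho F)%E.
Proof.
move=> p0 s0 c0 GF.
pose c' := c * \prod_k s k `^ (- rho k).
have c'0 : 0 < c'.
  by rewrite mulr_gt0//; apply: prodr_gt0 => k _; exact: powR_gt0.
pose H x := (Normc.normc ((weight rho x)%:C * F x))%:E.
transitivity (mixed_norm p (fun x => c'%:E * H (scale s x))%E).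
  congr (mixed_norm _ _); apply/funext => x; rewrite /H -EFinM; congr EFin.
  have [xo|xo] := boolP (off_hyperplanes x); last first.
    rewrite weight_scale// /weight (negbTE xo) mulr0.
    by rewrite !mul0r Normc.normc0 mulr0.
  rewrite GF// weight_scale//.
  have normC (r : R) : 0 < r -> Normc.normc r%:C = r.
    by move=> r0; rewrite /Normc.normc/= expr0n addr0 sqrtr_sqr gtr0_norm.
  rewrite !rmorphM/= !Normc.normcM (normC c)// (normC (\prod_k _)); last first.
    by apply: prodr_gt0 => k _; exact: powR_gt0.
  have : (\prod_k s k `^ (- rho k)) * (\prod_k s k `^ rho k) = 1.
    rewrite -big_split/= big1// => k _.
    by rewrite -powRD ?addNr ?powRr0//; apply/implyP => _; rewrite gt_eqF.
  rewrite /c'; set a := \prod_k _; set b := \prod_k _ => ab.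
  set w := Normc.normc (weight _ _)%:C; set h := Normc.normc _.
  rewrite (_ : c * a * _ = (a * b) * (w * (c * h))); last by ring.
  by rewrite ab mul1r.
rewrite mixed_norm_scale// /c' -mulrA -big_split/=.
congr ((_ * _)%:E * _)%E; apply: eq_bigr => k _.
by rewrite -powRD//; apply/implyP => _; rewrite gt_eqF.
Qed.

End norms.

(** * Dilations and the Abel Fourier transform *)

Section fourier.
Context {R : realType} {d : nat}.
Implicit Types (s : 'I_d -> R) (f g : point_of R d -> R[i]).

Lemma ae_off_hyperplanes :
  {ae @lebesgue_tuple R d, forall x, off_hyperplanes x}.
Proof.
pose H k := [set x : point_of R d | tnth x k = 0].
have mH k : measurable (H k).
  rewrite (_ : H k = (fun x : point_of R d => tnth x k) @^-1` [set 0])//.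
  by rewrite -[X in measurable X]setTI; apply: measurable_tnth.
suff : (lebesgue_tuple d).-negligible (\big[setU/set0]_(k < d) H k).
  apply: negligibleS => x /negP; rewrite negb_forall => /existsP[k].
  rewrite negbK => /eqP xk; rewrite -bigcup_seq; exists k => //=.
  by rewrite mem_index_enum.
elim/big_ind : _ => [|A B hA hB|k _].
- exact: negligible_set0.
- exact: negligibleU.
- by exists (H k); split => //; exact: lebesgue_tuple_hyperplane.
Qed.

(** Coordinate hyperplanes are null, so the arbitrary values of an even
    extension there do not contribute. *)
Lemma cintegral_ae f g :
  cmeasurable_fun setT f -> cmeasurable_fun setT g ->
  (forall x, off_hyperplanes x -> f x = g x) -> cintegral f = cintegral g.
Proof.
move=> [f1 f2] [g1 g2] fg; rewrite /cintegral /Rintegral.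
congr (fine _ +i* fine _);
  apply: ae_eq_integral => //; try exact/measurable_EFinP.
  by apply: filterS ae_off_hyperplanes => x xo _; rewrite fg.
by apply: filterS ae_off_hyperplanes => x xo _; rewrite fg.
Qed.

Lemma cintegral_scale s f : positive s ->
  cintegral (fun x => f (scale s x)) = (\prod_k (s k)^-1)%:C * cintegral f.
Proof.
move=> s0; rewrite /cintegral.
rewrite (Rintegral_scale (fun x => complex.Re (f x)) s0).
rewrite (Rintegral_scale (fun x => complex.Im (f x)) s0).
by apply/eqP; rewrite eq_complex/= !mul0r subr0 addr0 !eqxx.
Qed.

Lemma cmeasurable_damped (f : point_of R d -> R[i]) (e t : point_of R d -> R) :
  cmeasurable_fun setT f -> measurable_fun setT e -> measurable_fun setT t ->
  cmeasurable_fun setT (fun x => f x * (e x)%:C * cis (t x)).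
Proof.
move=> [fr fi] me mt.
have mc : measurable_fun setT (fun x => cos (t x)).
  apply: measurableT_comp mt; apply: continuous_measurable_fun.
  exact: continuous_cos.
have ms : measurable_fun setT (fun x => sin (t x)).
  apply: measurableT_comp mt; apply: continuous_measurable_fun.
  exact: continuous_sin.
split.
  rewrite (_ : (fun x => _) = fun x => complex.Re (f x) * e x * cos (t x) -
      complex.Im (f x) * e x * sin (t x)); last first.
    by apply/funext => x; case: (f x) => a b /=; ring.
  by apply: measurable_funB; apply: measurable_funM => //; exact: measurable_funM.
rewrite (_ : (fun x => _) = fun x => complex.Re (f x) * e x * sin (t x) +
    complex.Im (f x) * e x * cos (t x)); last first.
  by apply/funext => x; case: (f x) => a b /=; ring.
by apply: measurable_funD; apply: measurable_funM => //; exact: measurable_funM.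
Qed.

(** The comparison almost everywhere in [cintegral_ae] requires the integrand
    of the damped transform to be measurable. *)
Lemma cmeasurable_fourier f (eps : 'rV[R]_d) (xi : point_of R d) :
  cmeasurable_fun setT f ->
  cmeasurable_fun setT (fun x =>
    f x * (expR (- \sum_(k < d) eps ord0 k * `|tnth x k|))%:C
        * cis (\sum_(k < d) tnth x k * tnth xi k)).
Proof.
move=> mf; apply: cmeasurable_damped => //.
  apply: measurableT_comp => //; apply: measurable_funN.
  apply: measurable_sum => k; apply: measurable_funM => //.
  by apply: measurableT_comp => //; exact: measurable_tnth.
apply: measurable_sum => k; apply: measurable_funM => //.
exact: measurable_tnth.
Qed.

(** Substitution [x |-> s * x]: in the exponents the factor [s] is absorbed by
    dividing [eps] and [xi] by [s]. *)
Lemma damped_fourier_dilate s f g eps (xi : point_of R d) : positive s ->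
  cmeasurable_fun setT f -> cmeasurable_fun setT g ->
  (forall x, off_hyperplanes x -> g x = f (scale s x)) ->
  damped_fourier g eps xi = (\prod_k (s k)^-1)%:C *
    damped_fourier f (row_scale (fun k => (s k)^-1) eps)
                     (scale (fun k => (s k)^-1) xi).
Proof.
move=> s0 mf mg gf; rewrite /damped_fourier -cintegral_scale//.
apply: cintegral_ae; first exact: cmeasurable_fourier.
  have := cmeasurable_dilate s measurableT
    (cmeasurable_fourier (row_scale (fun k => (s k)^-1) eps)
       (scale (fun k => (s k)^-1) xi) mf).
  by rewrite preimage_setT.
move=> x xo; rewrite gf//; congr (_ * (expR (- _))%:C * cis _).
  apply: eq_bigr => k _; rewrite mxE tnth_scale normrM gtr0_norm//.
  by rewrite [(s k)^-1 * _]mulrC -mulrA mulKf// gt_eqF.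
apply: eq_bigr => k _; rewrite !tnth_scale.
by rewrite [s k * _]mulrC -mulrA mulVKf// gt_eqF.
Qed.

(** Uniqueness of limits along the filter needs it to be proper: every
    neighbourhood of 0 contains a vector with positive coordinates. *)
Lemma zero_plus_proper : ProperFilter (@zero_plus R d).
Proof.
split; last exact: within_filter.
rewrite /zero_plus/within/= => -[P P0 PA].
have /choice [x hx] : forall k, exists x : R, 0 < x /\ P ord0 k x.
  move=> k; have := P0 ord0 k; rewrite mxE => /nbhs_ballP[e /= e0 eP].
  exists (e / 2); split; first by rewrite divr_gt0.
  apply: eP; rewrite /ball/= sub0r normrN gtr0_norm ?divr_gt0//.
  by rewrite ltr_pdivrMr// ltr_pMr// ltr1n.
apply: (PA (\row_k x k)).
  by move=> i k /=; rewrite mxE (ord1 i); have [] := hx k.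
by move=> k; rewrite mxE; have [] := hx k.
Qed.

Lemma zero_plus_scale s (A : set 'rV[R]_d) : positive s ->
  zero_plus A -> zero_plus (row_scale s @^-1` A).
Proof.
move=> s0; rewrite /zero_plus/within/= => A0.
have r0 : row_scale s (0 : 'rV[R]_d) = 0 by apply/rowP => k; rewrite !mxE mulr0.
have cts : row_scale s @ (0 : 'rV[R]_d) --> (0 : 'rV[R]_d).
  by rewrite -[X in _ --> X]r0; exact: row_scale_continuous.
have A1 : nbhs (0 : 'rV[R]_d) [set v : 'rV[R]_d |
    (forall k, 0 < row_scale s v ord0 k) -> A (row_scale s v)] by exact: cts _ A0.
suff : nbhs (0 : 'rV[R]_d) [set v : 'rV[R]_d | (forall k, 0 < v ord0 k) ->
    A (row_scale s v)] by [].
apply: filterS A1 => v /= vA vp; apply: vA => k.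
by rewrite mxE mulr_gt0.
Qed.

(** A dilation is a homeomorphism fixing 0 and preserving positivity, hence it
    permutes the paths of damping parameters to [0+]. *)
Lemma zero_plus_fmap s : positive s ->
  (row_scale s @ (@zero_plus R d))%classic = @zero_plus R d.
Proof.
move=> s0; apply/seteqP; split => A; last exact: zero_plus_scale.
rewrite /fmap/= => /(zero_plus_scale (positiveV s0)).
congr zero_plus; apply/funext => v; rewrite /preimage/=; congr A.
by apply/rowP => k; rewrite !mxE mulVKf// gt_eqF.
Qed.

Lemma cvg_scale (K : numFieldType) (V : normedModType K) (T : Type)
    (F : set_system T) (FF : Filter F) (u : T -> V) (c : K) (l : V) : c != 0 ->
  (c *: u x @[x --> F] --> l) <-> (u x @[x --> F] --> c^-1 *: l).
Proof.
move=> c0; split => [h|h].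
  rewrite (_ : u = fun x => c^-1 *: (c *: u x)); first exact: cvgZr.
  by apply/funext => x; rewrite scalerK.
by rewrite -[l](scalerKV c0); exact: cvgZr.
Qed.

(** If [u] has no limit then neither has [c * u], and the default value 0 of a
    divergent limit is compatible with multiplication by [c]. *)
Lemma lim_scale (T : Type) (F : set_system T) (FF : ProperFilter F)
    (u : T -> R[i]^o) (c : R[i]) : c != 0 ->
  lim ((fun x => c * u x : R[i]^o) @ F) = c * lim (u @ F).
Proof.
move=> c0.
have H (l : R[i]^o) := @cvg_scale _ R[i]^o T F _ u c l c0.
have [[l ul]|nu] := pselect (exists l : R[i]^o, u @ F --> l).
  have -> : lim (u @ F) = l by apply: cvg_lim => //; exact: norm_hausdorff.
  apply: cvg_lim; first exact: norm_hausdorff.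
  by apply/H; rewrite (_ : c^-1 *: _ = l)//; exact: mulKf.
have -> : lim (u @ F) = 0 by apply: getPN => l ul; apply: nu; exists l.
rewrite mulr0; apply: getPN => l ul; apply: nu; exists (c^-1 *: l).
exact/H.
Qed.

Lemma abel_fourier_dilate s f g (xi : point_of R d) : positive s ->
  cmeasurable_fun setT f -> cmeasurable_fun setT g ->
  (forall x, off_hyperplanes x -> g x = f (scale s x)) ->
  abel_fourier g xi = (\prod_k (s k)^-1)%:C *
    abel_fourier f (scale (fun k => (s k)^-1) xi).
Proof.
move=> s0 mf mg gf; rewrite /abel_fourier off_hyperplanes_scale; last first.
  exact: positiveV.
case: (off_hyperplanes xi); last exact/esym/mulr0.
pose c : R[i] := (\prod_k (s k)^-1)%:C.
have c0 : c != 0 by rewrite eq_complex/= eqxx andbT gt_eqF// prodV_gt0.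
pose u eps := damped_fourier f eps (scale (fun k => (s k)^-1) xi).
have E : damped_fourier g eps xi @[eps --> zero_plus] =
    ((fun eps => c * u eps : R[i]^o) @ @zero_plus R d)%classic.
  rewrite -[X in _ = (_ @ X)%classic](zero_plus_fmap (positiveV s0)).
  rewrite (_ : (damped_fourier g)^~ xi =
      fun eps => c * u (row_scale (fun k => (s k)^-1) eps))//.
  by apply/funext => eps; exact: damped_fourier_dilate.
by rewrite E; exact: (lim_scale zero_plus_proper u c0).
Qed.

End fourier.

(** * Comparison of the two scaling exponents *)

Lemma even_extension_dilate (R : realType) (d : nat) (s : 'I_d -> R)
    (g f h : point_of R d -> R[i]) : positive s ->
  even_extension g f -> even_extension (dilate s g) h ->
  forall x, off_hyperplanes x -> h x = f (scale s x).
Proof.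
move=> s0 [_ fE] [_ hE] x xo.
rewrite hE// fE ?off_hyperplanes_scale//; congr g.
by apply: eq_from_tnth => k; rewrite !tnth_mktuple normrM gtr0_norm.
Qed.

(** A nonzero power of [t] takes every positive value as [t] runs over the
    positive reals, in particular [`|M| + 1]. *)
Lemma powR_bounded_eq0 (R : realType) (e M : R) :
  (forall t, 0 < t -> t `^ e <= M) -> e = 0.
Proof.
move=> tM; apply/eqP; apply/negPn/negP => e0.
have M0 : 0 < `|M| + 1 by rewrite ltr_pwDr.
have := tM ((`|M| + 1) `^ e^-1) (powR_gt0 _ M0).
rewrite -powRrM mulVf// powRr1 ?(ltW M0)// leNgt => /negP; apply.
by rewrite (le_lt_trans (ler_norm M))// ltrDl.
Qed.

Lemma fin_pos_ereal (R : realType) (x : \bar R) :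
  (0 < x < +oo)%E -> exists2 r : R, 0 < r & x = r%:E.
Proof. by case: x => [r| |] /andP[x0 xoo] //; exists r; rewrite -?lte_fin. Qed.

Lemma prod_single (R : realType) (d : nat) (k : 'I_d) (F : 'I_d -> R) (t : R) :
  (forall j, j != k -> F j = 1) -> F k = t -> \prod_j F j = t.
Proof. by move=> F1 Fk; rewrite (bigD1 k)//= big1 ?mulr1. Qed.

Theorem proposition4p3 (R : realType) (d : nat) (K : R) (lam : 'I_d -> R)
    (hd : (0 < d)%N) (hK : 1 <= K) (hlam : forall k, 1 <= lam k) :
  (forall (g : point_of R d -> R[i]) (s : 'I_d -> R),
     RMGM K lam g -> positive s ->
     RMGM K lam (dilate s g) /\
     (canonical_version g -> canonical_version (dilate s g))) /\
  (forall (p q alpha rho : 'I_d -> R)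
      (g f : point_of R d -> R[i])
      (f_ : ('I_d -> R) -> point_of R d -> R[i]),
     (forall k, 1 <= p k) -> (forall k, 1 <= q k) ->
     RMGM K lam g ->
     even_extension g f ->
     (0 < weighted_norm q alpha (abel_fourier f) < +oo)%E ->
     (0 < weighted_norm p rho f < +oo)%E ->
     (forall s, positive s -> even_extension (dilate s g) (f_ s)) ->
     (exists C : R, forall s, positive s ->
        (weighted_norm q alpha (abel_fourier (f_ s)) <=
         C%:E * weighted_norm p rho (f_ s))%E) ->
     forall k, rho k = 1 - (p k)^-1 - (q k)^-1 - alpha k).
Proof.
split=> [g s gK s0|p q alpha rho g f f_ p1 q1 _ gf].
  by split; [exact: RMGM_dilate|exact: canonical_version_dilate].
have p0 k : 0 < p k by exact: lt_le_trans (p1 k).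
have q0 k : 0 < q k by exact: lt_le_trans (q1 k).
move=> /fin_pos_ereal[A A0 AE] /fin_pos_ereal[B B0 BE] gf_ [C f_C] k.
suff : -1 + alpha k + (q k)^-1 + rho k + (p k)^-1 = 0 by lra.
apply: (@powR_bounded_eq0 _ _ (C * B / A)) => t t0.
(* dilate the k-th coordinate only, to isolate its exponent *)
pose s j := if j == k then t else 1.
have s0 : positive s by move=> j; rewrite /s; case: ifP.
have f_E := even_extension_dilate s0 gf (gf_ s s0).
have [mf _] := gf; have [mf_ _] := gf_ s s0.
have := f_C s s0.
rewrite (weighted_norm_scale (c := 1) rho p0 s0 ltr01 (F := f)); last first.
  by move=> x xo; rewrite f_E// mul1r.
rewrite (weighted_norm_scale alpha q0 (positiveV s0) (prodV_gt0 s0)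
  (F := abel_fourier f)); last first.
  by move=> x xo; exact: abel_fourier_dilate.
have sk : s k = t by rewrite /s eqxx.
have sj j : j != k -> s j = 1 by rewrite /s => /negPf ->.
have -> : \prod_j (s j)^-1 = t^-1.
  by apply: (@prod_single _ _ k) => [j /sj ->|]; rewrite ?invr1 ?sk.
have -> : \prod_j (s j)^-1 `^ (- alpha j - (q j)^-1) =
    t `^ (alpha k + (q k)^-1).
  apply: (@prod_single _ _ k) => [j /sj ->|]; first by rewrite invr1 powR1.
  by rewrite sk -(powR_inv1 (ltW t0)) -powRrM mulN1r opprB opprK addrC.
have -> : \prod_j s j `^ (- rho j - (p j)^-1) = t `^ (- rho k - (p k)^-1).
  by apply: (@prod_single _ _ k) => [j /sj ->|]; rewrite ?powR1 ?sk.
rewrite AE BE.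
rewrite -!EFinM lee_fin mul1r -(powR_inv1 (ltW t0)).
have tD a b : t `^ (a + b) = t `^ a * t `^ b.
  by rewrite powRD//; apply/implyP => _; rewrite gt_eqF.
rewrite -tD => h; rewrite ler_pdivlMr//.
have t'0 : 0 < t `^ (- rho k - (p k)^-1) by exact: powR_gt0.
rewrite -(ler_pM2r t'0) mulrAC -tD -mulrA [B * _]mulrC.
apply: le_trans h; rewrite le_eqVlt; apply/orP; left; apply/eqP.
by congr (_ `^ _ * _); lra.
Qed.
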